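(* Let $p>3$ be a prime and let $m\in\mathbb{Z}_p$ with $m(m-16)(m-256)\not\equiv 0 \pmod p$. Then $$\sum_{k=0}^{(p-1)/2}\frac{\binom{2k}k^3}{m^k} \equiv \Big(\frac {m(m-16)}p\Big)\sum_{k=0}^{\lfloor p/6\rfloor}\binom{2k}k\binom{3k}k\binom{6k}{3k} \Big(\frac m{(m-16)^3}\Big)^k \equiv \Big(\frac {m(m-256)}p\Big)\sum_{k=0}^{\lfloor p/6\rfloor}\binom{2k}k\binom{3k}k\binom{6k}{3k} \Big(\frac {m^2}{(256-m)^3}\Big)^k \pmod p.$$
   Context: For a prime $p$, $\mathbb{Z}_p$ denotes the set of rational numbers whose denominator is not divisible by $p$; congruences modulo $p$ are taken in $\mathbb{Z}_p$. For $a\in\mathbb{Z}_p$, $\big(\frac ap\big)$ is the Legendre symbol of $a$ (i.e. of any integer congruent to $a$ modulo $p$). $\lfloor x\rfloor$ is the greatest integer not exceeding $x$. *)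

(* Defs.v *)
From mathcomp Require Import all_boot all_order all_algebra ring.

Set Implicit Arguments.
Unset Strict Implicit.
Unset Printing Implicit Defensive.

Import Order.TTheory GRing.Theory Num.Theory.
Local Open Scope ring_scope.

(* The ring Z_p of rationals whose reduced denominator is prime to p. *)
Definition Zloc (p : nat) : pred rat := fun x => ~~ (p%:Z %| denq x)%Z.

(* Congruence modulo p in Z_p: both sides lie in Z_p and x - y \in p Z_p. *)
Definition eqmodp (p : nat) (x y : rat) : bool :=
  [&& x \in Zloc p, y \in Zloc p & (x - y) / p%:R \in Zloc p].

(* Legendre symbol of an integer, for p an odd prime. *)
Definition legendre (p : nat) (a : int) : int :=
  if (p%:Z %| a)%Z then 0
  else if [exists x : 'I_p, ((x%:Z ^+ 2 == a %[mod p%:Z])%Z)] then 1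
  else -1.

(* Legendre symbol of an element of Z_p, computed on its representative in
   {0, ..., p-1}; by [legendreqE] any congruent integer gives the same value.
   The value outside Z_p, where there is no representative, is junk. *)
Definition legendreq (p : nat) (x : rat) : int :=
  if [pick i : 'I_p | eqmodp p i%:R x] is Some i then legendre p i%:Z else 0.

Lemma ZlocP (p : nat) (x : rat) :
  reflect (exists2 d : int, ~~ (p%:Z %| d)%Z & exists n : int, x * d%:~R = n%:~R)
          (x \in Zloc p).
Proof.
have den0 : (denq x)%:~R != 0 :> rat by rewrite intr_eq0 denq_neq0.
apply: (iffP idP) => [xZ | [d pd [n xd]]].
  exists (denq x) => //; exists (numq x).
  by rewrite -{1}[x]divq_num_den divfK.
apply: contra pd => /dvdz_trans; apply.
have /eqP : (numq x * d)%:~R = (n * denq x)%:~R :> rat.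
  by rewrite !intrM -xd -{2}[x]divq_num_den mulrAC divfK.
rewrite eqr_int => /eqP e.
have : (denq x %| numq x * d)%Z by rewrite e dvdz_mull.
by rewrite Gauss_dvdzr // coprimez_sym /coprimez /gcdz (eqP (coprime_num_den x)).
Qed.

Lemma eqmodp_int (p : nat) (a b : int) (x : rat) : prime p ->
  eqmodp p a%:~R x -> eqmodp p b%:~R x -> (a = b %[mod p%:Z])%Z.
Proof.
move=> pr_p /and3P[_ _ /ZlocP[d pd [n ea]]] /and3P[_ _ /ZlocP[e pe [m eb]]].
have p0 : p%:R != 0 :> rat by rewrite pnatr_eq0 -lt0n prime_gt0.
have primeM (u v : int) : (p%:Z %| u * v)%Z = (p%:Z %| u)%Z || (p%:Z %| v)%Z.
  by rewrite !dvdzE abszM /= Euclid_dvdM.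
apply/eqP; rewrite eqz_mod_dvd.
have: (p%:Z %| (a - b) * (d * e))%Z.
  apply/dvdzP; exists (n * e - m * d).
  apply: (@intr_inj rat); rewrite !(intrM, intrB) -ea -eb.
  by field.
by rewrite !primeM (negPf pd) (negPf pe) !orbF.
Qed.

Lemma legendreqE (p : nat) (a : int) (x : rat) : prime p ->
  eqmodp p a%:~R x -> legendreq p x = legendre p a.
Proof.
move=> pr_p ax; have p_gt0 := prime_gt0 pr_p.
have p0 : p%:R != 0 :> rat by rewrite pnatr_eq0 -lt0n.
have legE (b : int) : (b = a %[mod p%:Z])%Z -> legendre p b = legendre p a.
  move=> eba; have dvdE c : (p%:Z %| c)%Z = (c == 0 %[mod p%:Z])%Z.
    by rewrite eqz_mod_dvd subr0.
  by rewrite /legendre !dvdE eba.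
rewrite /legendreq; case: pickP => [i ix | noi].
  by apply/legE/(eqmodp_int pr_p _ ax).
have pz : p%:Z != 0 by rewrite eqz_nat -lt0n.
have r0 : 0 <= (a %% p%:Z)%Z by rewrite modz_ge0.
have rp : (`|(a %% p%:Z)%Z| < p)%N.
  by rewrite -ltz_nat gez0_abs // ltz_pmod // ltz_nat.
have /negP[] := negbT (noi (Ordinal rp)); rewrite /=.
have -> : (`|(a %% p%:Z)%Z|%N)%:R = (a %% p%:Z)%Z%:~R :> rat.
  by rewrite -[in RHS](gez0_abs r0).
case/and3P: ax => _ xZ /ZlocP[d pd [n en]]; apply/and3P; split=> //.
  rewrite unfold_in denq_int dvdzE absz1 dvdn1 absz_nat.
  by case: (p) pr_p => [|[|]].
apply/ZlocP; exists d => //; exists (n - (a %/ p%:Z)%Z * d).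
have ea : a%:~R = (a %/ p%:Z)%Z%:~R * p%:R + (a %% p%:Z)%Z%:~R :> rat.
  by rewrite {1}(divz_eq a p%:Z) intrD intrM.
rewrite intrB intrM -en ea.
by field.
Qed.

(* Main.v *)
(* Put x = 1/m and n = (p-1)/2.  Over F_p both sides are polynomials in x of
   degree at most n: with w = 1 - 16x, E = x^2 (resp. w = 1 - 256x, E = -x) and
   b_k = (6k)!/((3k)! k!^3), Euler's criterion turns the Legendre symbol into
   w^n, and the right-hand side becomes R = sum_(k <= p/6) b_k E^k w^(n-3k).
   As n = -1/2 in F_p, R is the truncation of the classical pullback
   w^(-1/2) 3F2(1/6,1/2,5/6;1,1; 1728 E/w^3); hence R is annihilated by the
   hypergeometric operator of the series with coefficients binom(2k,k)^3.  The
   resulting recurrence determines the coefficients of R below degree p from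
   R(0) = 1. *)
Require Import Defs.
From mathcomp Require Import all_boot all_order all_algebra.
From mathcomp Require Import all_solvable all_field.
From mathcomp Require Import ring zify.
Import Order.TTheory GRing.Theory Num.Theory.
Local Open Scope ring_scope.
Set Implicit Arguments.
Unset Strict Implicit.
Unset Printing Implicit Defensive.

(** * Term ratios of the two families of binomial products *)

Definition sextic_coef (k : nat) : nat := 'C(2 * k, k) * 'C(3 * k, k) * 'C(6 * k, 3 * k).

Lemma sextic_coef_fact (k : nat) : (sextic_coef k * (k`! ^ 3 * (3 * k)`!) = (6 * k)`!)%N.
Proof.
have e1 : ('C(2 * k, k) * (k`! * k`!) = (2 * k)`!)%N.
  by rewrite -(@bin_fact (2 * k) k) ?leq_pmull // mul2n -addnn addnK.
have e2 : ('C(3 * k, k) * (k`! * (2 * k)`!) = (3 * k)`!)%N.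
  rewrite -(@bin_fact (3 * k) k) ?leq_pmull //.
  by have -> : (3 * k - k = 2 * k)%N by lia.
have e3 : ('C(6 * k, 3 * k) * ((3 * k)`! * (3 * k)`!) = (6 * k)`!)%N.
  rewrite -(@bin_fact (6 * k) (3 * k)) ?leq_mul //.
  by have -> : (6 * k - 3 * k = 3 * k)%N by lia.
by rewrite -e3 -[in X in _ = (_ * (_ * X))%N]e2 -e1 /sextic_coef; ring.
Qed.

(** Of the six new factors of (6k+6)!, the three even ones are twice the new factors of (3k+3)!,
    which leaves 8 and the odd ones. Since 8 * 6^3 = 1728, this is the term ratio of
    3F2(1/6,1/2,5/6;1,1; 1728 y). *)
Lemma sextic_coefS (k : nat) :
  (k.+1 ^ 3 * sextic_coef k.+1 = 8 * (6 * k + 1) * (6 * k + 3) * (6 * k + 5) * sextic_coef k)%N.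
Proof.
have := sextic_coef_fact k.+1.
have -> : (6 * k.+1 = (6 * k).+4.+2)%N by lia.
have -> : (3 * k.+1 = (3 * k).+3)%N by lia.
rewrite !factS -sextic_coef_fact => e.
have q0 : (0 < k`! ^ 3 * (3 * k)`! * ((3 * k).+1 * (3 * k).+2 * (3 * k).+3))%N.
  by rewrite !muln_gt0 ?expn_gt0 !fact_gt0.
apply/eqP; rewrite -(eqn_pmul2r q0); apply/eqP.
transitivity (sextic_coef k.+1 * ((k.+1 * k`!) ^ 3 *
   ((3 * k).+3 * ((3 * k).+2 * ((3 * k).+1 * (3 * k)`!)))))%N; first by ring.
by rewrite e; ring.
Qed.

Lemma central_binS (k : nat) :
  (k.+1 * 'C(2 * k.+1, k.+1) = 2 * (2 * k + 1) * 'C(2 * k, k))%N.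
Proof.
have fE j : ('C(2 * j, j) * (j`! * j`!) = (2 * j)`!)%N.
  by rewrite -(@bin_fact (2 * j) j) ?leq_pmull // mul2n -addnn addnK.
have := fE k.+1.
have -> : (2 * k.+1 = (2 * k).+2)%N by lia.
rewrite !factS -fE => e.
have q0 : (0 < k`! * k`! * k.+1)%N by rewrite !muln_gt0 !fact_gt0.
apply/eqP; rewrite -(eqn_pmul2r q0); apply/eqP.
transitivity ('C((2 * k).+2, k.+1) * (k.+1 * k`! * (k.+1 * k`!)))%N; first by ring.
by rewrite e; ring.
Qed.

(** * The Euler operator X d/dX *)

(* Defined through the locked \poly so that rewriting with the derivation rules
   does not unfold it to a product. *)
Definition theta (R : comNzRingType) (f : {poly R}) : {poly R} :=
  \poly_(i < size f) (i%:R * f`_i).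

Lemma coef_theta (R : comNzRingType) (f : {poly R}) (i : nat) :
  (theta f)`_i = i%:R * f`_i.
Proof.
by rewrite coef_poly; case: ltnP => // fi; rewrite nth_default // mulr0.
Qed.

Lemma theta_deriv (R : comNzRingType) (f : {poly R}) : theta f = 'X * f^`().
Proof.
apply/polyP => i; rewrite coef_theta coefXM.
by case: i => [|i] /=; rewrite ?mul0r // coef_deriv mulr_natl.
Qed.

Lemma thetaD (R : comNzRingType) (f g : {poly R}) :
  theta (f + g) = theta f + theta g.
Proof. by rewrite !theta_deriv derivD mulrDr. Qed.

Lemma thetaB (R : comNzRingType) (f g : {poly R}) :
  theta (f - g) = theta f - theta g.
Proof. by rewrite !theta_deriv derivB mulrBr. Qed.

Lemma thetaM (R : comNzRingType) (f g : {poly R}) :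
  theta (f * g) = theta f * g + f * theta g.
Proof. by rewrite !theta_deriv derivM; ring. Qed.

Lemma theta_nat (R : comNzRingType) (n : nat) : theta (n%:R : {poly R}) = 0.
Proof. by rewrite !theta_deriv -polyC_natr derivC mulr0. Qed.

(** The extra factor [f] avoids the exponent [k - 1], which is truncated at [k = 0]. *)
Lemma theta_exp (R : comNzRingType) (f : {poly R}) (k : nat) :
  f * theta (f ^+ k) = k%:R * theta f * f ^+ k.
Proof.
elim: k => [|k IH]; first by rewrite expr0 -[1]/(1%:R) theta_nat; ring.
by rewrite exprS thetaM mulrDr mulrCA IH -natr1; ring.
Qed.

Lemma theta1 (R : comNzRingType) : theta (1 : {poly R}) = 0.
Proof. exact: (theta_nat R 1). Qed.

Lemma theta0 (R : comNzRingType) : theta (0 : {poly R}) = 0.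
Proof. exact: (theta_nat R 0). Qed.

Lemma thetaX (R : comNzRingType) : theta 'X = 'X :> {poly R}.
Proof. by rewrite !theta_deriv derivX mulr1. Qed.

Lemma thetaN (R : comNzRingType) (f : {poly R}) : theta (- f) = - theta f.
Proof. by rewrite !theta_deriv derivN mulrN. Qed.

Definition thetaE := (theta0, theta1, theta_nat, thetaX, thetaN, thetaD, thetaM).

(** * The hypergeometric operator and its action on the terms of R *)

(* The operator theta^3 - 8 X (2 theta + 1)^3, which annihilates the series
   with coefficients binom(2k, k)^3. *)
Definition cubic_op (R : comNzRingType) (f : {poly R}) : {poly R} :=
  theta (theta (theta f)) -
  8 * 'X * (8 * theta (theta (theta f)) + 12 * theta (theta f) + 6 * theta f + f).

Lemma cubic_opD (R : comNzRingType) (f g : {poly R}) :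
  cubic_op (f + g) = cubic_op f + cubic_op g.
Proof. by rewrite /cubic_op !thetaD; ring. Qed.

Lemma cubic_op0 (R : comNzRingType) : cubic_op (0 : {poly R}) = 0.
Proof. by rewrite /cubic_op !theta_deriv !(derivC, mulr0, addr0, subr0). Qed.

Lemma cubic_op_natM (R : comNzRingType) (n : nat) (f : {poly R}) :
  cubic_op (n%:R * f) = n%:R * cubic_op f.
Proof.
have tn g : theta (n%:R * g) = n%:R * theta g by rewrite thetaM theta_nat; ring.
by rewrite /cubic_op !tn; ring.
Qed.

(* Clearing denominators in [theta T = (v / W) T]. *)
Lemma cubic_op_log_deriv (R : comNzRingType) (T v W : {poly R}) :
  W * theta T = v * T ->
  W ^+ 3 * cubic_op T =
  ((1 - 64 * 'X) * (W ^+ 2 * theta (theta v)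
                    + W * v * (2 * theta v - theta (theta W))
                    + (v - 2 * theta W) * (W * theta v + (v - theta W) * v))
   - 96 * 'X * W * (W * theta v + (v - theta W) * v)
   - 48 * 'X * W ^+ 2 * v - 8 * 'X * W ^+ 3) * T.
Proof.
move=> H1.
have H2 : W * theta (theta T) = theta v * T + v * theta T - theta W * theta T.
  by have := congr1 (@theta R) H1; rewrite !thetaM => <-; ring.
have H3 : W * theta (theta (theta T)) = theta (theta v) * T + 2 * theta v * theta T
   + v * theta (theta T) - theta (theta W) * theta T - 2 * theta W * theta (theta T).
  have := congr1 (@theta R) H2; rewrite thetaM thetaB !(thetaD, thetaM) => e.
  by apply: (addrI (theta W * theta (theta T))); rewrite e; ring.
(* [H2] and [H3] come from applying [theta] to [H1]; one factor [W] per derivative now turns each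
   iterate of [theta] on [T] into a multiple of [T]. *)
have K2 : W ^+ 2 * theta (theta T) = (W * theta v + (v - theta W) * v) * T.
  by rewrite expr2 -mulrA H2 mulrBr mulrDr 2!(mulrCA W _ (theta T)) H1; ring.
have K3 : W ^+ 3 * theta (theta (theta T)) =
   (W ^+ 2 * theta (theta v) + W * v * (2 * theta v - theta (theta W))
    + (v - 2 * theta W) * (W * theta v + (v - theta W) * v)) * T.
  rewrite exprSr -mulrA H3.
  transitivity (W ^+ 2 * theta (theta v) * T
      + W * (2 * theta v - theta (theta W)) * (W * theta T)
      + (v - 2 * theta W) * (W ^+ 2 * theta (theta T))); first by ring.
  by rewrite H1 K2; ring.
rewrite /cubic_op.
transitivity ((1 - 64 * 'X) * (W ^+ 3 * theta (theta (theta T)))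
   - 96 * 'X * W * (W ^+ 2 * theta (theta T)) - 48 * 'X * W ^+ 2 * (W * theta T)
   - 8 * 'X * W ^+ 3 * T); first by ring.
by rewrite K3 K2 H1; ring.
Qed.

(* In the application s is n - 3k, that is -1/2 - 3k modulo p; doubling
   eliminates s from the logarithmic derivative. *)
Lemma theta_term (R : idomainType) (E w : {poly R}) (a d k s : nat) :
  E != 0 -> w != 0 -> theta E = a%:R * E -> w = 1 - d%:R * 'X ->
  2 * s%:R + 6 * k%:R + 1 = 0 :> {poly R} ->
  2 * w * theta (E ^+ k * w ^+ s) =
  (2 * a%:R * k%:R * w + (6 * k%:R + 1) * d%:R * 'X) * (E ^+ k * w ^+ s).
Proof.
move=> E0 w0 tE ew es; apply: (mulfI E0).
have tw : theta w = - (d%:R * 'X).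
  by rewrite ew thetaB -[1]/(1%:R) thetaM !theta_nat !theta_deriv derivX; ring.
rewrite thetaM.
transitivity (2 * w * w ^+ s * (E * theta (E ^+ k))
              + 2 * E * E ^+ k * (w * theta (w ^+ s))); first by ring.
rewrite !theta_exp tE tw.
have -> : (6 * k%:R + 1) = - (2 * s%:R) :> {poly R}.
  by apply/eqP; rewrite -addr_eq0 addrC addrA es.
by ring.
Qed.

Lemma one_subX_neq0 (R : idomainType) (d : nat) : 1 - d%:R * 'X != 0 :> {poly R}.
Proof.
apply/eqP => /(congr1 (fun p : {poly R} => p.[0])); rewrite !hornerE.
by move/eqP; rewrite subr0 oner_eq0.
Qed.

(* With y = X^2 / w^3, one has 1 - 1728 y = (1 - 64 X) (1 + 8 X)^2 / w^3 and
   theta y = 2 (1 + 8 X) y / w; comparing leading coefficients of the two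
   third-order operators gives the factor 8 (1 + 8 X). *)
Lemma cubic_op_term16 (R : idomainType) (k s : nat) :
  (2 : {poly R}) != 0 ->
  2 * s%:R + 6 * k%:R + 1 = 0 :> {poly R} ->
  let w := 1 - 16 * 'X : {poly R} in
  w ^+ 3 * cubic_op (('X^2) ^+ k * w ^+ s) =
  8 * (1 + 8 * 'X) *
    (k%:R ^+ 3 * w ^+ 3
     - 8 * (6 * k%:R + 1) * (6 * k%:R + 3) * (6 * k%:R + 5) * 'X^2)
  * (('X^2) ^+ k * w ^+ s).
Proof.
move=> n2 es w.
have E0 : 'X^2 != 0 :> {poly R} by rewrite monic_neq0 ?monicXn.
have tE : theta 'X^2 = 2%:R * 'X^2 :> {poly R} by rewrite expr2 !thetaE; ring.
have := cubic_op_log_deriv (theta_term E0 (one_subX_neq0 R 16) tE (erefl _) es).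
(* [theta_term] has denominator W = 2w, so the identity carries (2w)^3 and the factor 2^3 has to be
   cancelled. *)
rewrite -/w => H; apply: (mulfI (expf_neq0 3 n2)).
rewrite [LHS]mulrA -[in LHS]exprMn {}H [RHS]mulrA.
by congr (_ * _); rewrite /w !thetaE; ring.
Qed.

(* Here y = - X / w^3, 1 - 1728 y = (1 - 64 X) (1 + 512 X)^2 / w^3 and
   theta y = (1 + 512 X) y / w. *)
Lemma cubic_op_term256 (R : idomainType) (k s : nat) :
  (2 : {poly R}) != 0 ->
  2 * s%:R + 6 * k%:R + 1 = 0 :> {poly R} ->
  let w := 1 - 256 * 'X : {poly R} in
  w ^+ 3 * cubic_op ((- 'X) ^+ k * w ^+ s) =
  (1 + 512 * 'X) *
    (k%:R ^+ 3 * w ^+ 3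
     - 8 * (6 * k%:R + 1) * (6 * k%:R + 3) * (6 * k%:R + 5) * (- 'X))
  * ((- 'X) ^+ k * w ^+ s).
Proof.
move=> n2 es w.
have E0 : - 'X != 0 :> {poly R} by rewrite oppr_eq0 monic_neq0 ?monicX.
have tE : theta (- 'X) = 1%:R * - 'X :> {poly R} by rewrite !thetaE; ring.
have := cubic_op_log_deriv (theta_term E0 (one_subX_neq0 R 256) tE (erefl _) es).
rewrite -/w => H; apply: (mulfI (expf_neq0 3 n2)).
rewrite [LHS]mulrA -[in LHS]exprMn {}H [RHS]mulrA.
by congr (_ * _); rewrite /w !thetaE; ring.
Qed.

(** * The truncated pullback in characteristic p *)

Lemma cubic_op_sum (R : comNzRingType) (I : Type) (r : seq I) (F : I -> {poly R}) :
  cubic_op (\sum_(i <- r) F i) = \sum_(i <- r) cubic_op (F i).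
Proof. exact: (big_morph _ (@cubic_opD R) (@cubic_op0 R)). Qed.

(** The coefficient of X^(k+1) in the equation gives (k+1)^3 f_(k+1) = 8 (2k+1)^3 f_k, and k+1 is
    invertible as long as k+1 < p. *)
Lemma cubic_op_eq0_coef (F : fieldType) (p : nat) (f : {poly F}) :
  p \in [pchar F] -> cubic_op f = 0 -> f`_0 = 1 ->
  forall k, (k < p)%N -> f`_k = ('C(2 * k, k) ^ 3)%:R.
Proof.
move=> pF Lf f0; elim=> [|k IH] kp; first by rewrite f0 bin0.
have k0 : k.+1%:R != 0 :> F by rewrite -(dvdn_pcharf pF) gtnNdvd.
have := congr1 (fun g : {poly F} => g`_k.+1) Lf.
have -> : cubic_op f = theta (theta (theta f)) -
  'X * (64%:R * theta (theta (theta f)) + 96%:R * theta (theta f) + 48%:R * theta f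
        + 8%:R * f) by rewrite /cubic_op; ring.
rewrite coefB coefXM coef0 /= !coefD -!polyC_natr !coefCM !coef_theta IH ?(ltnW kp) //.
move=> e; apply: (mulfI (expf_neq0 3 k0)).
rewrite -natrX -natrM -expnMn central_binS !(natrX, natrM, natrD).
by apply/eqP; rewrite -subr_eq0; apply/eqP; apply: etrans e; rewrite !natrX; ring.
Qed.

(** The hypothesis on [cubic_op] and the recurrence of [sextic_coef] make [cubic_op] of the left
    side telescope to 0, which fixes its coefficients below degree p. The size bounds give each term
    degree at most 3k + (n - 3k) = n, so nothing remains above [n]. *)
Lemma pullback_coef (F : fieldType) (p : nat) (E w g : {poly F}) :
  let n := (p %/ 2)%N in
  (3 < p)%N -> p \in [pchar F] -> E.[0] = 0 -> w.[0] = 1 ->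
  (size E <= 4)%N -> (size w <= 2)%N ->
  (forall k s : nat, 2 * s%:R + 6 * k%:R + 1 = 0 :> {poly F} ->
    w ^+ 3 * cubic_op (E ^+ k * w ^+ s) =
    g * (k%:R ^+ 3 * w ^+ 3 - 8 * (6 * k%:R + 1) * (6 * k%:R + 3) * (6 * k%:R + 5) * E)
    * (E ^+ k * w ^+ s)) ->
  \sum_(0 <= k < (p %/ 6).+1) (sextic_coef k)%:R * (E ^+ k * w ^+ (n - 3 * k)) =
  \poly_(k < n.+1) ('C(2 * k, k) ^ 3)%:R.
Proof.
move=> n p3 pF E0 w0 sE sw H; set K := (p %/ 6)%N.
have pr_p := pcharf_prime pF.
have p_odd : odd p by case/even_prime: pr_p => // ep; rewrite ep in p3.
have p_not3 : ~~ (3 %| p)%N by rewrite dvdn_prime2 //; case: eqP p3 => // <-.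
have wn0 : w != 0.
  by apply/eqP => we; move/eqP: w0; rewrite we horner0 eq_sym oner_eq0.
have p0 : p%:R = 0 :> {poly F} by rewrite -polyC_natr (pcharf0 pF).
have nE : p = (2 * n + 1)%N by rewrite /n; lia.
have kn (k : nat) : (k <= K)%N -> (3 * k <= n)%N by rewrite /K /n; lia.
set f := \sum_(0 <= k < K.+1) _.
have sf : (size f <= n.+1)%N.
  rewrite /f big_mkord; apply: (big_ind (fun q : {poly F} => (size q <= n.+1)%N)).
  - by rewrite size_poly0.
  - by move=> q r hq hr; rewrite (leq_trans (size_polyD _ _)) // geq_max hq.
  move=> i _; have := kn i (ltn_ord i); rewrite -polyC_natr mul_polyC => i3.
  have hE : (size (E ^+ i) <= 3 * i + 1)%N.
    rewrite (leq_trans (size_poly_exp_leq _ _)) // addn1 ltnS leq_mul2r.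
    by rewrite -subn1 leq_subLR sE orbT.
  have hw : (size (w ^+ (n - 3 * i)) <= n - 3 * i + 1)%N.
    rewrite (leq_trans (size_poly_exp_leq _ _)) // addn1 ltnS.
    by rewrite -[X in (_ <= X)%N]mul1n leq_mul2r -subn1 leq_subLR sw orbT.
  have := size_polyMleq (E ^+ i) (w ^+ (n - 3 * i)).
  have := size_scale_leq (sextic_coef i)%:R (E ^+ i * w ^+ (n - 3 * i)).
  by lia.
pose c k : {poly F} := 8 * (6 * k%:R + 1) * (6 * k%:R + 3) * (6 * k%:R + 5).
have bS k : (sextic_coef k.+1)%:R * k.+1%:R ^+ 3 = (sextic_coef k)%:R * c k.
  transitivity ((k.+1 ^ 3 * sextic_coef k.+1)%:R : {poly F}).
    by rewrite natrM natrX mulrC.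
  by rewrite sextic_coefS /c !(natrM, natrD); ring.
(* At k = p %/ 6 the exponent n - 3 * k.+1 of the next term is truncated, but its
   coefficient vanishes since p is 6k + 1 or 6k + 5. *)
have cK k : (k <= K)%N -> (n < 3 * k.+1)%N -> c k = 0.
  move=> kK kK1; have: (p == 6 * k + 1)%N || (p == 6 * k + 5)%N.
    by move: kK kK1 p_odd p_not3; rewrite /K /n; lia.
  rewrite /c; case/orP => /eqP pE; move: p0; rewrite pE natrD natrM => e0.
    by rewrite e0 !(mulr0, mul0r).
  by rewrite e0 mulr0.
have Lf : cubic_op f = 0.
  (* The k-th term contributes g (Z_k - Z_(k+1)). At the ends, Z_0 = 0 through the factor k^3, and
     Z_(K+1) = 0 through [bS] and [cK]. *)
  pose Z k : {poly F} :=
    (sextic_coef k)%:R * k%:R ^+ 3 * (w ^+ 3 * (E ^+ k * w ^+ (n - 3 * k))).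
  apply: (mulfI (expf_neq0 3 wn0)); rewrite mulr0 /f cubic_op_sum mulr_sumr.
  have eZ k : (0 <= k < K.+1)%N ->
    w ^+ 3 * cubic_op ((sextic_coef k)%:R * (E ^+ k * w ^+ (n - 3 * k)))
      = - (g * Z k.+1) - - (g * Z k).
    rewrite ltnS /= => kK; have k3 := kn k kK.
    rewrite cubic_op_natM mulrCA H -?/(c k); last first.
      (* The side condition of [H] holds at s = n - 3k because 2(n - 3k) + 6k + 1 = 2n + 1 = p. *)
      rewrite -[RHS]p0 {1}nE natrD natrM -{2}(subnK k3) natrD natrM.
      by ring.
    have [kK1|] := leqP (3 * k.+1) n.
      rewrite /Z bS; have -> : (n - 3 * k = (n - 3 * k.+1).+3)%N by lia.
      by rewrite !exprS; ring.
    by move=> kK1; rewrite /Z bS cK //; ring.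
  rewrite (telescope_sumr_eq (fun k => - (g * Z k)) _ _ eZ) // /Z bS cK //.
    by ring.
  by rewrite /K /n; lia.
have f0 : f`_0 = 1.
  rewrite -horner_coef0 /f big_nat_recl // hornerD horner_sum big1 ?addr0.
    by rewrite muln0 subn0 mul1r mul1r horner_exp w0 expr1n.
  by move=> k _; rewrite !hornerM !horner_exp E0 expr0n /= mul0r mulr0.
apply/polyP => k; rewrite coef_poly; case: ltnP => kn1.
  by apply: (cubic_op_eq0_coef pF Lf f0); lia.
by rewrite nth_default // (leq_trans sf).
Qed.

(** Where w(x) is invertible, E^k w^(n-3k) = w^n (E / w^3)^k, so w^n factors out. *)
Lemma pullback_horner (F : fieldType) (p : nat) (E w g : {poly F}) (x : F) :
  let n := (p %/ 2)%N in
  (3 < p)%N -> p \in [pchar F] -> E.[0] = 0 -> w.[0] = 1 ->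
  (size E <= 4)%N -> (size w <= 2)%N ->
  (forall k s : nat, 2 * s%:R + 6 * k%:R + 1 = 0 :> {poly F} ->
    w ^+ 3 * cubic_op (E ^+ k * w ^+ s) =
    g * (k%:R ^+ 3 * w ^+ 3 - 8 * (6 * k%:R + 1) * (6 * k%:R + 3) * (6 * k%:R + 5) * E)
    * (E ^+ k * w ^+ s)) ->
  w.[x] != 0 ->
  \sum_(0 <= k < n.+1) ('C(2 * k, k) ^ 3)%:R * x ^+ k =
  w.[x] ^+ n * \sum_(0 <= k < (p %/ 6).+1) (sextic_coef k)%:R * (E.[x] / w.[x] ^+ 3) ^+ k.
Proof.
move=> n p3 pF E0 w0 sE sw H wx0.
have := congr1 (fun f : {poly F} => f.[x]) (pullback_coef p3 pF E0 w0 sE sw H).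
rewrite horner_poly -/n horner_sum [in X in _ -> X = _]big_mkord => <-.
rewrite mulr_sumr big_nat [RHS]big_nat; apply: eq_bigr => k /andP[_].
rewrite ltnS => kK; have k3 : (3 * k <= n)%N by move: kK; rewrite /n; lia.
rewrite -polyC_natr hornerM hornerC hornerM !horner_exp expr_div_n -exprM.
rewrite -{2}(subnKC k3) exprD; field.
by rewrite expf_neq0.
Qed.

(** * The two pullbacks evaluated at 1/m *)

Lemma horner_one_subX (R : comNzRingType) (d : nat) (x : R) :
  (1 - d%:R * 'X).[x] = 1 - d%:R * x.
Proof. by rewrite -polyC_natr !hornerE. Qed.

Lemma size_one_subX (R : nzRingType) (d : nat) :
  (size (1 - d%:R * 'X : {poly R})%R <= 2)%N.
Proof.
rewrite (leq_trans (size_polyD _ _)) // size_poly1 size_polyN geq_max /=.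
by rewrite -polyC_natr mul_polyC (leq_trans (size_scale_leq _ _)) ?size_polyX.
Qed.

Lemma central_binom_cubes_16 (F : fieldType) (p : nat) (m : F) :
  let n := (p %/ 2)%N in
  (3 < p)%N -> p \in [pchar F] -> m != 0 -> m - 16 != 0 ->
  \sum_(0 <= k < n.+1) ('C(2 * k, k) ^ 3)%:R / m ^+ k =
  ((m - 16) / m) ^+ n *
  \sum_(0 <= k < (p %/ 6).+1) (sextic_coef k)%:R * (m / (m - 16) ^+ 3) ^+ k.
Proof.
move=> n p3 pF m0 m16.
have n2 : 2 != 0 :> {poly F}.
  by rewrite -polyC_natr polyC_eq0 -(dvdn_pcharf pF) gtnNdvd // (leq_trans _ p3).
have wE : (1 - 16%:R * 'X).[m^-1] = (m - 16) / m.
  by rewrite horner_one_subX; field.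
under eq_bigr => k _ do rewrite -exprVn.
rewrite (@pullback_horner F p 'X^2 (1 - 16%:R * 'X) (8 * (1 + 8 * 'X)) m^-1) //.
- rewrite wE -/n; congr (_ * _); apply: eq_bigr => k _; congr (_ * _ ^+ _).
  by rewrite !hornerE; field; rewrite m0 m16.
- by rewrite hornerXn expr0n.
- by rewrite horner_one_subX mulr0 subr0.
- by rewrite size_polyXn.
- exact: size_one_subX.
- by move=> k s; apply: cubic_op_term16.
- by rewrite wE mulf_neq0 ?invr_neq0.
Qed.

(** At x = 1/m the argument is E / w^3 = - m^2 / (m - 256)^3; the sign of E = -X is absorbed by the
    cube. *)
Lemma central_binom_cubes_256 (F : fieldType) (p : nat) (m : F) :
  let n := (p %/ 2)%N in
  (3 < p)%N -> p \in [pchar F] -> m != 0 -> m - 256 != 0 ->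
  \sum_(0 <= k < n.+1) ('C(2 * k, k) ^ 3)%:R / m ^+ k =
  ((m - 256) / m) ^+ n *
  \sum_(0 <= k < (p %/ 6).+1) (sextic_coef k)%:R * (m ^+ 2 / (256 - m) ^+ 3) ^+ k.
Proof.
move=> n p3 pF m0 m256.
have n2 : 2 != 0 :> {poly F}.
  by rewrite -polyC_natr polyC_eq0 -(dvdn_pcharf pF) gtnNdvd // (leq_trans _ p3).
have wE : (1 - 256%:R * 'X).[m^-1] = (m - 256) / m.
  by rewrite horner_one_subX; field.
under eq_bigr => k _ do rewrite -exprVn.
rewrite (@pullback_horner F p (- 'X) (1 - 256%:R * 'X) (1 + 512 * 'X) m^-1) //.
- rewrite wE -/n; congr (_ * _); apply: eq_bigr => k _; congr (_ * _ ^+ _).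
  by rewrite !hornerE; field; rewrite m0 m256 -oppr_eq0 opprB m256.
- by rewrite !hornerE oppr0.
- by rewrite horner_one_subX mulr0 subr0.
- by rewrite size_polyN size_polyX.
- exact: size_one_subX.
- by move=> k s; apply: cubic_op_term256.
- by rewrite wE mulf_neq0 ?invr_neq0.
Qed.

(** * Euler's criterion and the Legendre symbol *)

Lemma Fermat_Fp (p : nat) (a : 'F_p) : prime p -> a != 0 -> a ^+ p.-1 = 1.
Proof.
move=> pr_p a0; apply: (mulfI a0); rewrite -exprS prednK ?prime_gt0 // mulr1.
by rewrite -[RHS]expf_card card_Fp.
Qed.

Lemma Euler_criterion (p : nat) (a : 'F_p) : prime p -> (2 < p)%N -> a != 0 ->
  a ^+ (p %/ 2) = if [exists x : 'F_p, x ^+ 2 == a] then 1 else -1.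
Proof.
move=> pr_p p2 a0.
have pE : p.-1 = (p %/ 2 * 2)%N.
  have : odd p by case/even_prime: (pr_p) => // ep; rewrite ep in p2.
  by lia.
case: existsP => [[x /eqP xa] | nosq].
  rewrite -xa -exprM mulnC -pE Fermat_Fp //.
  by apply: contraNneq a0 => x0; rewrite -xa x0 expr0n.
have /hasP[z _ zP] : has p.-1.-primitive_root (enum (predC1 (0 : 'F_p))).
  apply: has_prim_root; rewrite ?enum_uniq //.
  - by rewrite -subn1 subn_gt0 (ltn_trans _ p2).
  - by apply/allP => x; rewrite mem_enum unity_rootE => x0; rewrite Fermat_Fp.
  - by rewrite -cardE cardC1 card_Fp.
have [i ai] := prim_rootP zP (Fermat_Fp pr_p a0).
apply/eqP; have := Fermat_Fp pr_p a0.
rewrite pE exprM => /eqP; rewrite sqrf_eq1 => /orP[/eqP a1|//].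
(* If a = z^i had a^((p-1)/2) = 1, then p - 1 would divide i (p-1)/2, so i would be even and z^(i/2)
   a square root of [a]. *)
case: nosq; exists (z ^+ (i %/ 2)); apply/eqP; rewrite -exprM ai; congr (z ^+ _).
have : (p.-1 %| i * (p %/ 2))%N by rewrite (prim_order_dvd zP) exprM -ai a1.
rewrite {1}pE mulnC dvdn_pmul2r ?divn_gt0 ?(ltnW p2) //.
by move/divnK.
Qed.

Lemma legendre_Fp (p : nat) (a : int) : prime p -> (2 < p)%N ->
  a%:~R != 0 :> 'F_p -> (legendre p a)%:~R = a%:~R ^+ (p %/ 2) :> 'F_p.
Proof.
move=> pr_p p2 a0; have chp := pchar_Fp pr_p.
rewrite Euler_criterion // /legendre (dvdz_pcharf chp) (negPf a0).
have -> : [exists x : 'I_p, (x%:Z ^+ 2 == a %[mod p%:Z])%Z] =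
          [exists x : 'F_p, x ^+ 2 == a%:~R].
  have sqE (x : nat) : (x%:Z ^+ 2 == a %[mod p%:Z])%Z = (x%:R ^+ 2 == a%:~R :> 'F_p).
    by rewrite eqz_mod_dvd (dvdz_pcharf chp) rmorphB rmorphXn subr_eq0.
  apply/existsP/existsP => [[x]|[x xa]]; first by rewrite sqE; exists x%:R.
  have xp : (x < p)%N by rewrite -[X in (_ < X)%N]Fp_cast.
  by exists (Ordinal xp); rewrite sqE /= natr_Zp.
by case: ifP.
Qed.

(** * Reduction from Z_p to F_p *)

(* [a] is the image of [x] under the reduction map from Z_p to F_p. *)
Definition reduces_to (p : nat) (x : rat) (a : 'F_p) : Prop :=
  exists d n : int,
    [/\ d%:~R != 0 :> 'F_p, x * d%:~R = n%:~R & a * d%:~R = n%:~R].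

Lemma reduces_to_int (p : nat) (a : int) : reduces_to a%:~R (a%:~R : 'F_p).
Proof. by exists 1, a; rewrite !mulr1 oner_eq0. Qed.

Lemma reduces_to_nat (p n : nat) : reduces_to n%:R (n%:R : 'F_p).
Proof. exact: reduces_to_int n. Qed.

Lemma reduces_toB (p : nat) (x y : rat) (a b : 'F_p) :
  reduces_to x a -> reduces_to y b -> reduces_to (x - y) (a - b).
Proof.
move=> [d [n [d0 xd ad]]] [e [m [e0 ye be]]]; exists (d * e), (n * e - m * d).
by split; rewrite ?(intrM, intrB) ?mulf_neq0 // -?xd -?ye -?ad -?be; ring.
Qed.

Lemma reduces_toM (p : nat) (x y : rat) (a b : 'F_p) :
  reduces_to x a -> reduces_to y b -> reduces_to (x * y) (a * b).
Proof.
move=> [d [n [d0 xd ad]]] [e [m [e0 ye be]]]; exists (d * e), (n * m).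
by split; rewrite ?intrM ?mulf_neq0 // -?xd -?ye -?ad -?be; ring.
Qed.

Lemma reduces_toD (p : nat) (x y : rat) (a b : 'F_p) :
  reduces_to x a -> reduces_to y b -> reduces_to (x + y) (a + b).
Proof.
move=> xa yb; have := reduces_toB xa (reduces_toB (reduces_to_nat p 0) yb).
by rewrite !sub0r !opprK.
Qed.

(** The numerator and denominator of the witness trade places; [n] is a unit modulo p because [a]
    and [d] are. *)
Lemma reduces_toV (p : nat) (x : rat) (a : 'F_p) :
  a != 0 -> reduces_to x a -> reduces_to x^-1 a^-1.
Proof.
move=> a0 [d [n [d0 xd ad]]]; exists n, d.
have n0 : n%:~R != 0 :> 'F_p by rewrite -ad mulf_neq0.
split=> //; last by rewrite -ad mulKf.
rewrite -xd mulKf //; apply: contraNneq n0 => x0.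
by move: xd; rewrite x0 mul0r => /esym/eqP; rewrite intr_eq0 => /eqP ->.
Qed.

Lemma reduces_toX (p k : nat) (x : rat) (a : 'F_p) :
  reduces_to x a -> reduces_to (x ^+ k) (a ^+ k).
Proof.
move=> xa; elim: k => [|k IH]; first exact: (reduces_to_nat p 1).
by rewrite !exprS; apply: reduces_toM.
Qed.

Lemma reduces_to_sum (p m n : nat) (f : nat -> rat) (g : nat -> 'F_p) :
  (forall k, reduces_to (f k) (g k)) ->
  reduces_to (\sum_(m <= k < n) f k) (\sum_(m <= k < n) g k).
Proof.
move=> fg; elim/big_ind2: _ => //; first exact: (reduces_to_nat p 0).
by move=> *; apply: reduces_toD.
Qed.

Lemma reduces_to_Zloc (p : nat) (x : rat) (a : 'F_p) : prime p ->
  reduces_to x a -> x \in Zloc p.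
Proof.
move=> pr_p [d [n [d0 xd _]]]; apply/ZlocP; exists d; last by exists n.
by rewrite (dvdz_pcharf (pchar_Fp pr_p)).
Qed.

Lemma Zloc_reduces_to (p : nat) (x : rat) : prime p ->
  x \in Zloc p -> exists a : 'F_p, reduces_to x a.
Proof.
move=> pr_p /ZlocP[d pd [n xd]]; rewrite (dvdz_pcharf (pchar_Fp pr_p)) in pd.
by exists (n%:~R / d%:~R), d, n; rewrite divfK.
Qed.

(** The difference has image 0, so p divides its numerator. This turns equalities in F_p into
    congruences in Z_p. *)
Lemma reduces_to_eqmodp (p : nat) (x y : rat) (a : 'F_p) : prime p ->
  reduces_to x a -> reduces_to y a -> eqmodp p x y.
Proof.
move=> pr_p xa ya; rewrite /eqmodp (reduces_to_Zloc pr_p xa) (reduces_to_Zloc pr_p ya) /=.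
have [d [n [d0 xd]]] := reduces_toB xa ya.
rewrite subrr mul0r => /esym/eqP; rewrite -(dvdz_pcharf (pchar_Fp pr_p)) => /dvdzP[q nq].
apply/ZlocP; exists d; first by rewrite (dvdz_pcharf (pchar_Fp pr_p)).
exists q; rewrite mulrAC xd nq intrM mulfK //.
by rewrite pnatr_eq0 -lt0n prime_gt0.
Qed.

(** The canonical representative of [a] is an integer congruent to [x], so the symbol may be
    computed there by Euler's criterion. *)
Lemma legendreq_reduces_to (p : nat) (x : rat) (a : 'F_p) :
  prime p -> (2 < p)%N -> a != 0 -> reduces_to x a ->
  reduces_to (legendreq p x)%:~R (a ^+ (p %/ 2)).
Proof.
move=> pr_p p2 a0 xa; have aE : (a : nat)%:~R = a by rewrite -[RHS]natr_Zp.
rewrite (legendreqE (a := (a : nat)) pr_p); last first.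
  apply: reduces_to_eqmodp xa => //; rewrite -[X in reduces_to _ X]aE.
  by apply: reduces_to_int.
by rewrite -{2}aE -legendre_Fp ?aE //; apply: reduces_to_int.
Qed.

(** * Transfer of the identities over F_p to the congruences *)

Theorem theorem2p1 (p : nat) (m : rat) (hp : prime p) (hp3 : (3 < p)%N)
    (hm : m \in Zloc p)
    (hm0 : ~~ eqmodp p (m * (m - 16%:R) * (m - 256%:R)) 0) :
  eqmodp p
    (\sum_(0 <= k < ((p - 1) %/ 2).+1) ('C(2 * k, k) ^ 3)%:R / m ^+ k)
    ((legendreq p (m * (m - 16%:R)))%:~R *
     \sum_(0 <= k < (p %/ 6).+1)
       ('C(2 * k, k) * 'C(3 * k, k) * 'C(6 * k, 3 * k))%:R
       * (m / (m - 16%:R) ^+ 3) ^+ k)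
  /\
  eqmodp p
    ((legendreq p (m * (m - 16%:R)))%:~R *
     \sum_(0 <= k < (p %/ 6).+1)
       ('C(2 * k, k) * 'C(3 * k, k) * 'C(6 * k, 3 * k))%:R
       * (m / (m - 16%:R) ^+ 3) ^+ k)
    ((legendreq p (m * (m - 256%:R)))%:~R *
     \sum_(0 <= k < (p %/ 6).+1)
       ('C(2 * k, k) * 'C(3 * k, k) * 'C(6 * k, 3 * k))%:R
       * (m ^+ 2 / (256%:R - m) ^+ 3) ^+ k).
Proof.
have [u mu] := Zloc_reduces_to hp hm.
have hp2 := ltnW hp3; have chp := pchar_Fp hp.
have natp n := reduces_to_nat p n.
have u16 := reduces_toB mu (natp 16); have u256 := reduces_toB mu (natp 256).
have u256' := reduces_toB (natp 256) mu.
have : u * (u - 16%:R) * (u - 256%:R) != 0.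
  apply: contraNneq hm0 => u0; apply: (@reduces_to_eqmodp p _ _ 0) => //.
    by rewrite -u0; do 2?apply: reduces_toM.
  exact: natp 0.
rewrite !mulf_eq0 !negb_or -andbA => /and3P[n0 n16 n256].
have n256' : 256%:R - u != 0 by rewrite -oppr_eq0 opprB.
have nE : ((p - 1) %/ 2 = p %/ 2)%N.
  have : odd p by case/even_prime: (hp) => // ep; rewrite ep in hp3.
  by lia.
(* The pullback produces v/u, the Legendre symbol uv; they differ by u^2, whose power is u^(p-1) =
   1. *)
have expE (v : 'F_p) : (v / u) ^+ (p %/ 2) = (u * v) ^+ (p %/ 2).
  have -> : u * v = v / u * u ^+ 2 by field.
  rewrite [RHS]exprMn -exprM.
  have -> : (2 * (p %/ 2) = p.-1)%N by lia.
  by rewrite Fermat_Fp // mulr1.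
pose S := \sum_(0 <= k < (p %/ 2).+1) ('C(2 * k, k) ^ 3)%:R / u ^+ k.
have red1 : reduces_to (\sum_(0 <= k < (p %/ 2).+1) ('C(2 * k, k) ^ 3)%:R / m ^+ k) S.
  apply: reduces_to_sum => k; apply: reduces_toM => //; apply: reduces_toV.
    by rewrite expf_neq0.
  exact: reduces_toX.
(* All three expressions reduce to the same [S]; the middle one is therefore treated once for each
   congruence. *)
rewrite nE; split; apply: (@reduces_to_eqmodp p _ _ S) => //.
- rewrite /S (central_binom_cubes_16 hp3 chp n0 n16) expE; apply: reduces_toM.
    by apply: legendreq_reduces_to; rewrite ?mulf_neq0 //; apply: reduces_toM.
  apply: reduces_to_sum => k; apply: reduces_toM => //; apply: reduces_toX.
  by apply: reduces_toM => //; apply: reduces_toV; [rewrite expf_neq0|apply: reduces_toX].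
- rewrite /S (central_binom_cubes_16 hp3 chp n0 n16) expE; apply: reduces_toM.
    by apply: legendreq_reduces_to; rewrite ?mulf_neq0 //; apply: reduces_toM.
  apply: reduces_to_sum => k; apply: reduces_toM => //; apply: reduces_toX.
  by apply: reduces_toM => //; apply: reduces_toV; [rewrite expf_neq0|apply: reduces_toX].
- rewrite /S (central_binom_cubes_256 hp3 chp n0 n256) expE; apply: reduces_toM.
    by apply: legendreq_reduces_to; rewrite ?mulf_neq0 //; apply: reduces_toM.
  apply: reduces_to_sum => k; apply: reduces_toM => //; apply: reduces_toX.
  apply: reduces_toM; first exact: reduces_toX.
  by apply: reduces_toV; [rewrite expf_neq0|apply: reduces_toX].
Qed.
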